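(* Let $\mathcal{C}$ be a codifferential category with finite coproducts. Let $(A,\nu)$ be a $T$-algebra and $M$ a module (with action $\bullet: A\otimes M\to M$) over its associated commutative algebra. Define $\beta=\langle\beta_1,\beta_2\rangle: T(A\oplus M)\to A\oplus M$ by $$\beta_1 = T\pi_1;\nu : T(A\oplus M)\to TA\to A,$$ $$\beta_2 = d_{T(A\oplus M)};(T\pi_1\otimes\pi_2);(\nu\otimes 1_M);\bullet : T(A\oplus M)\to T(A\oplus M)\otimes(A\oplus M)\to TA\otimes M\to A\otimes M\to M.$$ Then $(A\oplus M,\beta)$ is a $T$-algebra.
   Context: Composition is written in diagrammatic order: $f;g$ means first $f$, then $g$. Monoidal structures are written as if strict, with unit $k$ and symmetry $c$. An additive symmetric monoidal category is a symmetric monoidal category enriched over commutative monoids (hom-sets have addition and zero, composition is bilinear) whose tensor functor is additive in both variables. In such a category finite coproducts are biproducts, written $\oplus$, with projections $\pi_1,\pi_2$ and pairing $\langle f,g\rangle$. A commutative algebra is a commutative monoid object; modules are left modules. An algebra modality on a symmetric monoidal category consists of a monad $(T,\mu,\eta)$ and, for each object $C$, morphisms $m:TC\otimes TC\to TC$, $e:k\to TC$ making $TC$ a commutative algebra, such that $m,e$ are natural in $C$ (each $Tf$ is an algebra homomorphism) and each $\mu_C:T^2C\to TC$ is an algebra homomorphism. A codifferential category is an additive symmetric monoidal category with an algebra modality $T$ and a deriving transform, i.e. a transformation $d_{TC}:TC\to TC\otimes C$, natural in $C$, such that: (d1) $e;d=0$; (d2) $m;d=(1\otimes d);(m\otimes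 1)+(d\otimes 1);c;(m\otimes 1)$, where $c$ here is the symmetry $TC\otimes C\otimes TC\to TC\otimes TC\otimes C$; (d3) $\eta;d=e\otimes 1$; (d4) $\mu_C;d_{TC}=d_{T^2C};(\mu_C\otimes d_{TC});(m\otimes 1_C)$. Each $T$-algebra (Eilenberg--Moore algebra) $(A,\nu)$ has an associated commutative algebra structure with multiplication $(\eta_A\otimes\eta_A);m;\nu: A\otimes A\to A$ and unit $e;\nu:k\to A$; every map of $T$-algebras, and $\nu: TA\to A$ itself, is then an algebra homomorphism. *)

(* Defs.v *)
From mathcomp Require Import ssreflect ssrfun.

Set Implicit Arguments.
Unset Strict Implicit.
Unset Printing Implicit Defensive.

Declare Scope cat_scope.
Delimit Scope cat_scope with cat.
Local Open Scope cat_scope.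

Reserved Notation "a ~> b" (at level 99, b at level 200).
Reserved Notation "f \; g" (at level 60, right associativity).
Reserved Notation "a ⊗ b" (at level 40, left associativity).
Reserved Notation "f ⊠ g" (at level 40, left associativity).

Record category := Category {
  obj :> Type;
  hom : obj -> obj -> Type;
  idm : forall a, hom a a;
  compm : forall a b c, hom a b -> hom b c -> hom a c;
  comp1m : forall a b (f : hom a b), compm (idm a) f = f;
  compm1 : forall a b (f : hom a b), compm f (idm b) = f;
  compmA : forall a b c d (f : hom a b) (g : hom b c) (h : hom c d),
    compm f (compm g h) = compm (compm f g) h }.

Arguments hom {c} : rename.
Arguments idm {c} a : rename.

Notation "a ~> b" := (hom a b) : type_scope.
Notation "f \; g" := (compm f g) : cat_scope.

(* No strictness: associator and unitors are explicit. *)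
Record smcat := SMCat {
  smcat_cat :> category;
  tens : smcat_cat -> smcat_cat -> smcat_cat;
  tensm : forall a b a' b' : smcat_cat,
    (a ~> a') -> (b ~> b') -> (tens a b ~> tens a' b');
  munit : smcat_cat;
  assoc : forall a b c, tens (tens a b) c ~> tens a (tens b c);
  assocV : forall a b c, tens a (tens b c) ~> tens (tens a b) c;
  lunit : forall a, tens munit a ~> a;
  lunitV : forall a, a ~> tens munit a;
  runit : forall a, tens a munit ~> a;
  runitV : forall a, a ~> tens a munit;
  sym : forall a b, tens a b ~> tens b a;
  tensm_id : forall a b, tensm (idm a) (idm b) = idm (tens a b);
  tensm_comp : forall (a b a' b' a'' b'' : smcat_cat)
      (f : a ~> a') (f' : a' ~> a'') (g : b ~> b') (g' : b' ~> b''),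
    tensm (f \; f') (g \; g') = tensm f g \; tensm f' g';
  assocK : forall a b c, assoc a b c \; assocV a b c = idm _;
  assocVK : forall a b c, assocV a b c \; assoc a b c = idm _;
  lunitK : forall a, lunit a \; lunitV a = idm _;
  lunitVK : forall a, lunitV a \; lunit a = idm _;
  runitK : forall a, runit a \; runitV a = idm _;
  runitVK : forall a, runitV a \; runit a = idm _;
  symK : forall a b, sym a b \; sym b a = idm _;
  assoc_nat : forall (a b c a' b' c' : smcat_cat)
      (f : a ~> a') (g : b ~> b') (h : c ~> c'),
    tensm (tensm f g) h \; assoc a' b' c' =
    assoc a b c \; tensm f (tensm g h);
  lunit_nat : forall (a a' : smcat_cat) (f : a ~> a'),
    tensm (idm munit) f \; lunit a' = lunit a \; f;
  runit_nat : forall (a a' : smcat_cat) (f : a ~> a'),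
    tensm f (idm munit) \; runit a' = runit a \; f;
  sym_nat : forall (a b a' b' : smcat_cat) (f : a ~> a') (g : b ~> b'),
    tensm f g \; sym a' b' = sym a b \; tensm g f;
  pentagon : forall a b c d,
    assoc (tens a b) c d \; assoc a b (tens c d) =
    tensm (assoc a b c) (idm d) \; assoc a (tens b c) d
      \; tensm (idm a) (assoc b c d);
  triangle : forall a b,
    assoc a munit b \; tensm (idm a) (lunit b) = tensm (runit a) (idm b);
  hexagon : forall a b c,
    assoc a b c \; sym a (tens b c) \; assoc b c a =
    tensm (sym a b) (idm c) \; assoc b a c \; tensm (idm b) (sym a c) }.

Arguments munit {s} : rename.
Arguments assoc {s} a b c : rename.
Arguments assocV {s} a b c : rename.
Arguments lunit {s} a : rename.
Arguments lunitV {s} a : rename.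
Arguments runit {s} a : rename.
Arguments runitV {s} a : rename.
Arguments sym {s} a b : rename.

Notation "a ⊗ b" := (tens a b) : cat_scope.
Notation "f ⊠ g" := (tensm f g) : cat_scope.

Definition symr (C : smcat) (a b c : C) : (a ⊗ b) ⊗ c ~> (a ⊗ c) ⊗ b :=
  assoc a b c \; (idm a ⊠ sym b c) \; assocV a c b.

Record additive_smcat := AdditiveSMCat {
  asm_smcat :> smcat;
  homD : forall a b : asm_smcat, (a ~> b) -> (a ~> b) -> (a ~> b);
  hom0 : forall a b : asm_smcat, a ~> b;
  homDA : forall a b, associative (@homD a b);
  homDC : forall a b, commutative (@homD a b);
  hom0D : forall a b, left_id (hom0 a b) (@homD a b);
  compDm : forall (a b c : asm_smcat) (f g : a ~> b) (h : b ~> c),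
    homD f g \; h = homD (f \; h) (g \; h);
  compmD : forall (a b c : asm_smcat) (h : a ~> b) (f g : b ~> c),
    h \; homD f g = homD (h \; f) (h \; g);
  comp0m : forall (a b c : asm_smcat) (h : b ~> c),
    hom0 a b \; h = hom0 a c;
  compm0 : forall (a b c : asm_smcat) (h : a ~> b),
    h \; hom0 b c = hom0 a c;
  tensDm : forall (a b a' b' : asm_smcat) (f g : a ~> a') (h : b ~> b'),
    homD f g ⊠ h = homD (f ⊠ h) (g ⊠ h);
  tensmD : forall (a b a' b' : asm_smcat) (h : a ~> a') (f g : b ~> b'),
    h ⊠ homD f g = homD (h ⊠ f) (h ⊠ g);
  tens0m : forall (a b a' b' : asm_smcat) (h : b ~> b'),
    hom0 a a' ⊠ h = hom0 (a ⊗ b) (a' ⊗ b');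
  tensm0 : forall (a b a' b' : asm_smcat) (h : a ~> a'),
    h ⊠ hom0 b b' = hom0 (a ⊗ b) (a' ⊗ b') }.

Arguments hom0 {a0} a b : rename.

Notation "f + g" := (homD f g) : cat_scope.
Notation "0" := (hom0 _ _) : cat_scope.

Record fincoproducts (C : category) := FinCoproducts {
  initial : C;
  from_initial : forall a, initial ~> a;
  from_initialE : forall a (f : initial ~> a), f = from_initial a;
  coprod : C -> C -> C;
  inj1 : forall a b, a ~> coprod a b;
  inj2 : forall a b, b ~> coprod a b;
  copair : forall a b c : C, (a ~> c) -> (b ~> c) -> (coprod a b ~> c);
  inj1_copair : forall (a b c : C) (f : a ~> c) (g : b ~> c),
    inj1 a b \; copair f g = f;
  inj2_copair : forall (a b c : C) (f : a ~> c) (g : b ~> c),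
    inj2 a b \; copair f g = g;
  copairE : forall (a b c : C) (h : coprod a b ~> c),
    h = copair (inj1 a b \; h) (inj2 a b \; h) }.

(* In an additive category coproducts are biproducts: bproj1, bproj2 and bpair
   below are the product structure on a coproduct (see biproductP). *)
Definition bproj1 (C : additive_smcat) (S : fincoproducts C) (a b : C) :
  coprod S a b ~> a := copair S (idm a) 0.

Definition bproj2 (C : additive_smcat) (S : fincoproducts C) (a b : C) :
  coprod S a b ~> b := copair S 0 (idm b).

Definition bpair (C : additive_smcat) (S : fincoproducts C) (x a b : C)
    (f : x ~> a) (g : x ~> b) : x ~> coprod S a b :=
  (f \; inj1 S a b) + (g \; inj2 S a b).

Lemma copair_eq (C : category) (S : fincoproducts C) (a b c : C)
    (f g : coprod S a b ~> c) :
  inj1 S a b \; f = inj1 S a b \; g -> inj2 S a b \; f = inj2 S a b \; g ->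
  f = g.
Proof. by move=> e1 e2; rewrite (copairE f) (copairE g) e1 e2. Qed.

Lemma biproductP (C : additive_smcat) (S : fincoproducts C) (x a b : C)
    (f : x ~> a) (g : x ~> b) (h : x ~> coprod S a b) :
  h = bpair S f g <-> h \; bproj1 S a b = f /\ h \; bproj2 S a b = g.
Proof.
have homD0 (y z : C) (k : y ~> z) : k + 0 = k by rewrite homDC hom0D.
split=> [->|[<- <-]].
  rewrite /bpair /bproj1 /bproj2 !compDm -!compmA !inj1_copair !inj2_copair.
  by rewrite !compm1 !compm0 homD0 hom0D.
rewrite /bpair !(esym (compmA _ _ _)) -compmD -[LHS]compm1; congr (_ \; _).
apply: (copair_eq (S := S)); rewrite compmD !compmA /bproj1 /bproj2.
  by rewrite !inj1_copair comp1m compm1 comp0m homD0.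
by rewrite !inj2_copair comp1m compm1 comp0m hom0D.
Qed.

Record is_comm_algebra (C : smcat) (a : C) (m : a ⊗ a ~> a) (e : munit ~> a) :
    Prop := IsCommAlgebra {
  algA : (m ⊠ idm a) \; m = assoc a a a \; (idm a ⊠ m) \; m;
  alg1m : (e ⊠ idm a) \; m = lunit a;
  algm1 : (idm a ⊠ e) \; m = runit a;
  algC : sym a a \; m = m }.

Definition is_alg_hom (C : smcat) (a b : C) (ma : a ⊗ a ~> a) (ea : munit ~> a)
    (mb : b ⊗ b ~> b) (eb : munit ~> b) (f : a ~> b) : Prop :=
  ma \; f = (f ⊠ f) \; mb /\ ea \; f = eb.

Record comm_algebra (C : smcat) := CommAlgebra {
  alg_obj :> C;
  alg_mul : alg_obj ⊗ alg_obj ~> alg_obj;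
  alg_unit : munit ~> alg_obj;
  alg_axioms : is_comm_algebra alg_mul alg_unit }.

Arguments alg_mul {C} c : rename.
Arguments alg_unit {C} c : rename.

Record module (C : smcat) (A : comm_algebra C) := Module {
  mod_obj :> C;
  mod_act : A ⊗ mod_obj ~> mod_obj;
  mod1 : (alg_unit A ⊠ idm mod_obj) \; mod_act = lunit mod_obj;
  modA : (alg_mul A ⊠ idm mod_obj) \; mod_act =
         assoc A A mod_obj \; (idm A ⊠ mod_act) \; mod_act }.

Arguments mod_act {C A} m : rename.

Record monad (C : category) := Monad {
  mon_obj :> C -> C;
  mon_map : forall a b : C, (a ~> b) -> (mon_obj a ~> mon_obj b);
  mon_mu : forall a, mon_obj (mon_obj a) ~> mon_obj a;
  mon_eta : forall a, a ~> mon_obj a;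
  mon_map_id : forall a, mon_map (idm a) = idm (mon_obj a);
  mon_map_comp : forall (a b c : C) (f : a ~> b) (g : b ~> c),
    mon_map (f \; g) = mon_map f \; mon_map g;
  mon_mu_nat : forall (a b : C) (f : a ~> b),
    mon_map (mon_map f) \; mon_mu b = mon_mu a \; mon_map f;
  mon_eta_nat : forall (a b : C) (f : a ~> b),
    f \; mon_eta b = mon_eta a \; mon_map f;
  mon_muA : forall a,
    mon_map (mon_mu a) \; mon_mu a = mon_mu (mon_obj a) \; mon_mu a;
  mon_eta_mu : forall a, mon_eta (mon_obj a) \; mon_mu a = idm (mon_obj a);
  mon_mapeta_mu : forall a, mon_map (mon_eta a) \; mon_mu a = idm (mon_obj a) }.

Definition is_Talgebra (C : category) (T : monad C) (a : C) (nu : T a ~> a) :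
    Prop :=
  mon_eta T a \; nu = idm a /\ mon_map T nu \; nu = mon_mu T a \; nu.

Record Talgebra (C : category) (T : monad C) := TAlgebra {
  talg_obj :> C;
  talg_str : T talg_obj ~> talg_obj;
  talg_axioms : is_Talgebra talg_str }.

Arguments talg_str {C T} t : rename.

Record algebra_modality (C : smcat) := AlgebraModality {
  am_monad :> monad C;
  am_m : forall a, am_monad a ⊗ am_monad a ~> am_monad a;
  am_e : forall a, munit ~> am_monad a;
  am_alg : forall a, is_comm_algebra (am_m a) (am_e a);
  am_map_hom : forall (a b : C) (f : a ~> b),
    is_alg_hom (am_m a) (am_e a) (am_m b) (am_e b) (mon_map am_monad f);
  am_mu_hom : forall a,
    is_alg_hom (am_m (am_monad a)) (am_e (am_monad a)) (am_m a) (am_e a)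
      (mon_mu am_monad a) }.

Record codifferential_cat := CodifferentialCat {
  cod_cat :> additive_smcat;
  cod_T : algebra_modality cod_cat;
  cod_d : forall a, cod_T a ~> cod_T a ⊗ a;
  cod_d_nat : forall (a b : cod_cat) (f : a ~> b),
    mon_map cod_T f \; cod_d b = cod_d a \; (mon_map cod_T f ⊠ f);
  cod_d1 : forall a, am_e cod_T a \; cod_d a = 0;
  cod_d2 : forall a,
    am_m cod_T a \; cod_d a =
      ((idm (cod_T a) ⊠ cod_d a) \; assocV (cod_T a) (cod_T a) a
         \; (am_m cod_T a ⊠ idm a))
      + ((cod_d a ⊠ idm (cod_T a)) \; symr (cod_T a) a (cod_T a)
         \; (am_m cod_T a ⊠ idm a));
  cod_d3 : forall a,
    mon_eta cod_T a \; cod_d a = lunitV a \; (am_e cod_T a ⊠ idm a);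
  cod_d4 : forall a,
    mon_mu cod_T a \; cod_d a =
      cod_d (cod_T a) \; (mon_mu cod_T a ⊠ cod_d a)
        \; assocV (cod_T a) (cod_T a) a \; (am_m cod_T a ⊠ idm a) }.

Arguments cod_d {c} a : rename.

Definition talg_mul (C : smcat) (T : algebra_modality C) (A : Talgebra T) :
    A ⊗ A ~> A :=
  (mon_eta T A ⊠ mon_eta T A) \; am_m T A \; talg_str A.

Definition talg_unit (C : smcat) (T : algebra_modality C) (A : Talgebra T) :
    munit ~> A :=
  am_e T A \; talg_str A.

Lemma talg_str_hom (C : smcat) (T : algebra_modality C) (A : Talgebra T) :
  is_alg_hom (am_m T A) (am_e T A) (talg_mul A) (talg_unit A) (talg_str A).
Proof.
split=> //; have [_ nuA] := talg_axioms A.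
rewrite /talg_mul !compmA -tensm_comp !(mon_eta_nat T) tensm_comp.
have [mN _] := am_map_hom T (talg_str A).
have [mM _] := am_mu_hom T A.
rewrite -[(_ \; (_ ⊠ _)) \; _]compmA -mN -!compmA nuA.
rewrite [am_m _ _ \; (_ \; _)]compmA mM !compmA -tensm_comp.
by rewrite !mon_eta_mu tensm_id comp1m.
Qed.

Lemma talg_is_comm_algebra (C : smcat) (T : algebra_modality C)
    (A : Talgebra T) : is_comm_algebra (talg_mul A) (talg_unit A).
Proof.
have [nu1 _] := talg_axioms A; have [mA m1 mr mC] := am_alg T A.
have [nuM nuE] := talg_str_hom A; set nu := talg_str A in nu1 nuM nuE *.
set eta := mon_eta T A in nu1 *.
have mulE : talg_mul A = (eta ⊠ eta) \; am_m T A \; nu by [].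
split.
- have -> : talg_mul A ⊠ idm A =
      ((eta ⊠ eta) ⊠ eta) \; (am_m T A ⊠ idm (T A)) \; (nu ⊠ nu).
    by rewrite -!tensm_comp comp1m nu1.
  have -> : idm A ⊠ talg_mul A =
      (eta ⊠ (eta ⊠ eta)) \; (idm (T A) ⊠ am_m T A) \; (nu ⊠ nu).
    by rewrite -!tensm_comp comp1m nu1.
  rewrite -!compmA -nuM [(am_m _ _ ⊠ idm _) \; _]compmA mA.
  by rewrite !compmA -assoc_nat.
- have -> : talg_unit A ⊠ idm A =
      (idm munit ⊠ eta) \; (am_e T A ⊠ idm (T A)) \; (nu ⊠ nu).
    by rewrite -!tensm_comp !comp1m nu1.
  rewrite -!compmA -nuM [(am_e _ _ ⊠ idm _) \; _]compmA m1.
  by rewrite compmA lunit_nat -compmA nu1 compm1.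
- have -> : idm A ⊠ talg_unit A =
      (eta ⊠ idm munit) \; (idm (T A) ⊠ am_e T A) \; (nu ⊠ nu).
    by rewrite -!tensm_comp !comp1m nu1.
  rewrite -!compmA -nuM [(idm _ ⊠ am_e _ _) \; _]compmA mr.
  by rewrite compmA runit_nat -compmA nu1 compm1.
- by rewrite mulE !compmA -sym_nat -[(_ \; sym _ _) \; _]compmA mC.
Qed.

Definition talg_alg (C : smcat) (T : algebra_modality C) (A : Talgebra T) :
    comm_algebra C :=
  CommAlgebra (talg_is_comm_algebra A).

Definition beta1 (C : codifferential_cat) (S : fincoproducts C)
    (A : Talgebra (cod_T C)) (M : module (talg_alg A)) :
    cod_T C (coprod S A M) ~> A :=
  mon_map (cod_T C) (bproj1 S A M) \; talg_str A.

Definition beta2 (C : codifferential_cat) (S : fincoproducts C)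
    (A : Talgebra (cod_T C)) (M : module (talg_alg A)) :
    cod_T C (coprod S A M) ~> M :=
  cod_d (coprod S A M) \; (mon_map (cod_T C) (bproj1 S A M) ⊠ bproj2 S A M)
    \; (talg_str A ⊠ idm M) \; mod_act M.

Definition beta (C : codifferential_cat) (S : fincoproducts C)
    (A : Talgebra (cod_T C)) (M : module (talg_alg A)) :
    cod_T C (coprod S A M) ~> coprod S A M :=
  bpair S (beta1 S M) (beta2 S M).

(* Main.v *)
From mathcomp Require Import ssreflect ssrfun.
Require Import Defs.

(** Both axioms are checked after the two biproduct projections. On the first
    they say that [T pi1; nu] is compatible with the monad. On the second, the
    unit law is (d3) together with the unit law of [M], and associativity is the
    chain rule (d4) together with associativity of the action, because
    [beta1 = T pi1; nu] is an algebra homomorphism. *)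

Set Implicit Arguments.
Unset Strict Implicit.
Unset Printing Implicit Defensive.

Local Open Scope cat_scope.

Lemma bproj_eq (C : additive_smcat) (S : fincoproducts C) (x a b : C)
    (f g : x ~> coprod S a b) :
  f \; bproj1 S a b = g \; bproj1 S a b ->
  f \; bproj2 S a b = g \; bproj2 S a b -> f = g.
Proof.
move=> e1 e2; rewrite (proj2 (biproductP _ _ f) (conj e1 e2)).
by symmetry; apply/biproductP.
Qed.

Lemma assocV_nat (C : smcat) (a b c a' b' c' : C)
    (f : a ~> a') (g : b ~> b') (h : c ~> c') :
  assocV a b c \; ((f ⊠ g) ⊠ h) = (f ⊠ (g ⊠ h)) \; assocV a' b' c'.
Proof.
rewrite -[LHS]compm1 -(assocK a' b' c') -compmA [_ \; (assoc _ _ _ \; _)]compmA.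
by rewrite assoc_nat !compmA assocVK comp1m.
Qed.

Lemma is_alg_hom_comp (C : smcat) (a b c : C)
    (ma : a ⊗ a ~> a) (ea : munit ~> a) (mb : b ⊗ b ~> b) (eb : munit ~> b)
    (mc : c ⊗ c ~> c) (ec : munit ~> c) (f : a ~> b) (g : b ~> c) :
  is_alg_hom ma ea mb eb f -> is_alg_hom mb eb mc ec g ->
  is_alg_hom ma ea mc ec (f \; g).
Proof.
move=> [fM fE] [gM gE]; split; last by rewrite compmA fE.
by rewrite compmA fM -compmA gM compmA tensm_comp.
Qed.

(** Associativity of the action is solved for the nested action, because (d4) produces [assocV]
    followed by a multiplication. *)
Lemma modAV (C : smcat) (A : comm_algebra C) (M : module A) :
  assocV A A M \; (alg_mul A ⊠ idm M) \; mod_act M =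
  (idm A ⊠ mod_act M) \; mod_act M.
Proof. by rewrite modA compmA assocVK comp1m. Qed.

Section Beta.
Variables (C : codifferential_cat) (S : fincoproducts C).
Variables (A : Talgebra (cod_T C)) (M : module (talg_alg A)).

Local Notation T := (cod_T C).
Local Notation B := (coprod S A M).
Local Notation p1 := (bproj1 S A M).
Local Notation p2 := (bproj2 S A M).
Local Notation b1 := (beta1 S M).
Local Notation b2 := (beta2 S M).

Lemma beta_bproj1 : beta S M \; p1 = b1.
Proof. by have [] := proj1 (biproductP b1 b2 (beta S M)) erefl. Qed.

Lemma beta_bproj2 : beta S M \; p2 = b2.
Proof. by have [] := proj1 (biproductP b1 b2 (beta S M)) erefl. Qed.

Lemma beta1_hom :
  is_alg_hom (am_m T B) (am_e T B) (talg_mul A) (talg_unit A) b1.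
Proof. exact: is_alg_hom_comp (am_map_hom T p1) (talg_str_hom A). Qed.

(** By interchange [T p1] and the structure map of [A] merge into [b1], so the homomorphism laws of
    [b1] apply to the first tensor factor. *)
Lemma beta2E : b2 = cod_d B \; (b1 ⊠ p2) \; mod_act M.
Proof.
by rewrite /beta2 [_ \; (talg_str A ⊠ _) \; _]compmA -tensm_comp compm1.
Qed.

Lemma eta_beta1 : mon_eta T B \; b1 = p1.
Proof.
have [nu1 _] := talg_axioms A.
by rewrite /beta1 compmA -mon_eta_nat -compmA nu1 compm1.
Qed.

Lemma eta_beta2 : mon_eta T B \; b2 = p2.
Proof.
have [_ b1E] := beta1_hom.
rewrite beta2E compmA cod_d3 -compmA [(_ ⊠ _) \; _ \; _]compmA -tensm_comp.
(* The inserted identities let interchange move [p2] ahead of the unit, which exposes the unit law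
   of [M]. *)
rewrite b1E comp1m -[talg_unit A]comp1m -[p2 in LHS]compm1 tensm_comp -compmA.
by rewrite (mod1 M) lunit_nat compmA lunitVK comp1m.
Qed.

Lemma map_beta_beta1 : mon_map T (beta S M) \; b1 = mon_mu T B \; b1.
Proof.
have [_ nuA] := talg_axioms A.
rewrite {1}/beta1 compmA -mon_map_comp beta_bproj1 /beta1 mon_map_comp.
by rewrite -compmA nuA !compmA mon_mu_nat.
Qed.

Lemma map_beta_beta2 : mon_map T (beta S M) \; b2 = mon_mu T B \; b2.
Proof.
have [b1M _] := beta1_hom.
(* The middle term acts twice on [M]. The left side reaches it by naturality of [cod_d], with
   [map_beta_beta1] on the first factor and [b2] unfolded on the second. *)
transitivity (cod_d (T B) \; (mon_mu T B ⊠ cod_d B) \; (b1 ⊠ (b1 ⊠ p2))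
                \; (idm A ⊠ mod_act M) \; mod_act M).
  rewrite {1}beta2E !compmA cod_d_nat -!compmA; congr (_ \; _).
  rewrite !compmA -!tensm_comp beta_bproj2 map_beta_beta1 compm1.
  by rewrite beta2E !compmA.
(* After (d4) the right side multiplies in [T B] and then applies [b1]; the middle term, by [modAV],
   applies [b1] and then multiplies in [A]. These agree as [b1] preserves products. *)
rewrite beta2E [RHS]compmA cod_d4 -(modAV M) -!compmA; congr (_ \; _ \; _).
rewrite [(am_m _ _ ⊠ _) \; _]compmA -tensm_comp b1M comp1m -[p2 in RHS]compm1 tensm_comp.
by rewrite !compmA assocV_nat.
Qed.

End Beta.

Theorem theorem4p1 (C : codifferential_cat) (S : fincoproducts C)
    (A : Talgebra (cod_T C)) (M : module (talg_alg A)) :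
  is_Talgebra (beta S M).
Proof.
split; apply: bproj_eq; rewrite -?compmA ?comp1m ?beta_bproj1 ?beta_bproj2.
- exact: eta_beta1.
- exact: eta_beta2.
- exact: map_beta_beta1.
- exact: map_beta_beta2.
Qed.
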